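(* Let $S^1\times_c\mathrm{Diff}^+(S^1)$ be the Virasoro-Bott group with Lie algebra $\mathbb R\times_\omega\mathfrak X(S^1)$ and the right invariant weak Riemannian metric induced by $\left\langle\binom ha,\binom kb\right\rangle=\int_{S^1}hk\,dx+ab$. Let $\binom ua$ be the right trivialized velocity field of a geodesic, i.e. $a$ is constant and $u_t=-3u_xu-au_{xxx}$. Then a smooth right trivialized vector field $\binom yb$ along this geodesic is a Jacobi field if and only if $$\begin{aligned}y_{tt}&=-u(4y_{tx}+3uy_{xx}+ay_{xxxx})-u_x(2y_t+2ay_{xxx})-u_{xxx}\big(b_t+\omega(y,u)-3ay_x\big)-ay_{txxx},\\ b_{tt}&=\omega(u,y_t)+\omega(y,3u_xu)+\omega(y,au_{xxx}).\end{aligned}$$ Moreover, for every Jacobi field the quantity $$B_1:=b_t+\omega(y,u)=b_t+\int_{S^1}y_{xxx}u\,dx$$ is constant in $t$; hence $b(t)=B_0+B_1t-\int_{t_0}^t\int_{S^1}y_{xxx}u\,dx\,dt$ for a constant $B_0$ (where $t_0$ is a fixed initial time), and $y$ satisfies $$y_{tt}=-u(4y_{tx}+3uy_{xx}+ay_{xxxx})-u_x(2y_t+2ay_{xxx})-u_{xxx}(B_1-3ay_x)-ay_{txxx}.$$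
   Context: Vector fields $h\partial_x$ on $S^1$ are identified with functions $h$. The Virasoro-Bott group is the central extension $S^1\times\mathrm{Diff}^+(S^1)$ with product $\binom\varphi\alpha\binom\psi\beta=\binom{\varphi\circ\psi}{\alpha\beta e^{2\pi ic(\varphi,\psi)}}$, where $c(\varphi,\psi)=\int_{S^1}\log(\varphi'\circ\psi)\,d\log\psi'$. Its Lie algebra is $\mathbb R\times_\omega\mathfrak X(S^1)$, with elements $\binom ha$, $h\in\mathfrak X(S^1)$, $a\in\mathbb R$, and bracket $$\left[\binom ha,\binom kb\right]=\binom{h'k-hk'}{\omega(h,k)},\qquad \omega(h,k)=\int_{S^1}h'k''\,dx$$ (the Lie algebra of the central circle being identified with $\mathbb R$ with the normalization for which the bracket has this form). The right invariant metric is obtained by right translating the inner product; right trivialization identifies each tangent space with the Lie algebra by right translation. A Jacobi field along a geodesic with right trivialized velocity $U=\binom ua$ is a vector field $Y=\binom yb$ along it satisfying $\nabla_{\partial_t}\nabla_{\partial_t}Y+\mathcal R(Y,U)U=0$ ($\nabla$ the Levi-Civita covariant derivative, $\mathcal R(X,Y)=[\nabla_X,\nabla_Y]-\nabla_{[X,Y]}$ its curvature); equivalently, in right trivialization, $Y_{tt}=[\mathrm{ad}(Y)^\top+\mathrm{ad}(Y),\mathrm{ad}(U)^\top]U-\mathrm{ad}(U)^\top Y_t-\alpha(U)Y_t+\mathrm{ad}(U)Y_t$, where $\mathrm{ad}(X)Y=[X,Y]$, $\mathrm{ad}(X)^\top$ is the adjoint with respect to the inner product and $\alpha(X)Z=\mathrm{ad}(Z)^\top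 X$. *)

(* Defs.v *)
From Stdlib Require Import Reals Lra Lia FunctionalExtensionality.
From Coquelicot Require Import Coquelicot.
Open Scope R_scope.

(* The circle is R / L Z for an arbitrary circumference L > 0, so that
   L = 1 and L = 2 PI are both covered; functions on it are L-periodic
   functions on R, and the integral over it is the one over [0, L]. *)

Definition smooth (f : R -> R) : Prop :=
  forall (n : nat) (x : R), ex_derive_n f n x.

Definition smooth_on (I : R -> Prop) (f : R -> R) : Prop :=
  forall (n : nat) (t : R), I t -> ex_derive_n f n t.

Definition periodic (L : R) (f : R -> R) : Prop :=
  forall x : R, f (x + L) = f x.

(* A time dependent function on the circle is written f t x, with t the time. *)
Definition dt (f : R -> R -> R) (t x : R) : R := Derive (fun s : R => f s x) t.
Definition dx (n : nat) (f : R -> R -> R) (t x : R) : R := Derive_n (f t) n x.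

(* f is of class C^n on I x R, for an open set I of times. *)
Fixpoint Ck2 (I : R -> Prop) (n : nat) (f : R -> R -> R) : Prop :=
  (forall t x : R, I t -> continuity_2d_pt f t x) /\
  match n with
  | O => True
  | S m =>
      (forall t x : R, I t ->
         ex_derive (fun s : R => f s x) t /\ ex_derive (f t) x) /\
      Ck2 I m (dt f) /\ Ck2 I m (dx 1 f)
  end.

Definition smooth_field (L : R) (I : R -> Prop) (f : R -> R -> R) : Prop :=
  (forall n : nat, Ck2 I n f) /\ (forall t : R, I t -> periodic L (f t)).

Definition time_interval (T1 T2 : Rbar) (t : R) : Prop :=
  Rbar_lt T1 t /\ Rbar_lt t T2.

(* A pair (h, a) stands for the element of R x_omega X(S^1) with vector field
   part h d/dx and central part a; it lies in the Lie algebra when h is smooth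
   and periodic. *)
Definition vir : Type := ((R -> R) * R)%type.

Definition in_vir (L : R) (X : vir) : Prop :=
  smooth (fst X) /\ periodic L (fst X).

Definition vzero : vir := (fun _ : R => 0, 0).
Definition vplus (X Y : vir) : vir :=
  (fun x : R => fst X x + fst Y x, snd X + snd Y).
Definition vopp (X : vir) : vir := (fun x : R => - fst X x, - snd X).
Definition vminus (X Y : vir) : vir := vplus X (vopp Y).

Definition omega (L : R) (h k : R -> R) : R :=
  RInt (fun x : R => Derive h x * Derive_n k 2 x) 0 L.

Definition bracket (L : R) (X Y : vir) : vir :=
  (fun x : R => Derive (fst X) x * fst Y x - fst X x * Derive (fst Y) x,
   omega L (fst X) (fst Y)).

Definition inner (L : R) (X Y : vir) : R :=
  RInt (fun x : R => fst X x * fst Y x) 0 L + snd X * snd Y.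

(* Write R_X for the right invariant vector field on the group generated by X.
   The Lie bracket of vector fields satisfies [R_X, R_Y] = - R_[X,Y], and
   <R_X, R_Y> is constant.  The Levi-Civita connection of the right invariant
   metric is right invariant, hence given by a map Gamma on the Lie algebra
   with nabla_(R_X) R_Y = R_(Gamma X Y); the two equations below say that it is
   torsion free and that it preserves the metric.  They determine Gamma on the
   Lie algebra (Koszul) and imply its bilinearity. *)
Definition levi_civita (L : R) (Gamma : vir -> vir -> vir) : Prop :=
  forall X Y : vir, in_vir L X -> in_vir L Y ->
    in_vir L (Gamma X Y) /\
    vminus (Gamma X Y) (Gamma Y X) = vopp (bracket L X Y) /\
    forall Z : vir, in_vir L Z ->
      inner L (Gamma X Y) Z + inner L Y (Gamma X Z) = 0.

(* [nabla_X, nabla_Y] Z - nabla_[X,Y] Z on right invariant fields; the last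
   term has a plus sign because [R_X, R_Y] = - R_[X,Y]. *)
Definition curvature (L : R) (Gamma : vir -> vir -> vir) (X Y Z : vir) : vir :=
  vplus (vminus (Gamma X (Gamma Y Z)) (Gamma Y (Gamma X Z)))
        (Gamma (bracket L X Y) Z).

Definition vdt (Y : R -> vir) (t : R) : vir :=
  (fun x : R => dt (fun s : R => fst (Y s)) t x,
   Derive (fun s : R => snd (Y s)) t).

(* Covariant derivative of the right trivialized field Y along a curve in the
   group with right trivialized velocity U. *)
Definition cov_dt (Gamma : vir -> vir -> vir) (U Y : R -> vir) (t : R) : vir :=
  vplus (vdt Y t) (Gamma (U t) (Y t)).

Definition geodesic (Gamma : vir -> vir -> vir) (I : R -> Prop)
    (U : R -> vir) : Prop :=
  forall t : R, I t -> cov_dt Gamma U U t = vzero.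

Definition jacobi_field (L : R) (Gamma : vir -> vir -> vir) (I : R -> Prop)
    (U Y : R -> vir) : Prop :=
  forall t : R, I t ->
    vplus (cov_dt Gamma U (cov_dt Gamma U Y) t)
          (curvature L Gamma (Y t) (U t) (U t)) = vzero.

(* The metric being only weak, the existence of a Levi-Civita connection is
   not automatic. *)

Lemma smooth_Derive_n (f : R -> R) (k : nat) :
  smooth f -> smooth (Derive_n f k).
Proof.
intros Hf n x. destruct n as [|n]; [exact I|].
generalize (Hf (S (n + k)) x); simpl; apply ex_derive_ext.
intros t; symmetry; apply Derive_n_comp.
Qed.

Lemma smooth_ex_derive (f : R -> R) (x : R) : smooth f -> ex_derive f x.
Proof. intros Hf; exact (Hf 1%nat x). Qed.

Lemma smooth_const (c : R) : smooth (fun _ => c).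
Proof. intros n x; apply ex_derive_n_const. Qed.

Lemma smooth_plus (f g : R -> R) :
  smooth f -> smooth g -> smooth (fun x => f x + g x).
Proof.
intros Hf Hg n x; apply ex_derive_n_plus; apply filter_forall; intros y k _;
  [apply Hf | apply Hg].
Qed.

Lemma smooth_mult (f g : R -> R) :
  smooth f -> smooth g -> smooth (fun x => f x * g x).
Proof.
intros Hf Hg n x.
enough (H : forall f g, smooth f -> smooth g ->
          forall m, (m <= n)%nat ->
          forall y, ex_derive_n (fun x => f x * g x) m y)
  by (apply H; auto).
clear f g Hf Hg x.
induction n as [|n IH]; intros f g Hf Hg m Hm y.
{ replace m with 0%nat by lia; exact I. }
destruct m as [|[|m]]; [exact I| |].
{ simpl; apply (ex_derive_mult f g y); apply smooth_ex_derive; assumption. }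
assert (E : ex_derive_n (Derive (fun y => f y * g y)) (S m) y).
{ apply ex_derive_n_ext with
    (f := fun y => Derive f y * g y + f y * Derive g y).
  { intros t; symmetry; apply Derive_mult; apply smooth_ex_derive; assumption. }
  apply ex_derive_n_plus; apply filter_forall; intros z k Hk; apply IH; try lia;
    auto; apply (smooth_Derive_n _ 1); assumption. }
simpl in E |- *; revert E; apply ex_derive_ext; intros t.
transitivity (Derive_n (fun y => f y * g y) (m + 1) t);
  [exact (Derive_n_comp (fun y => f y * g y) m 1 t)|].
replace (m + 1)%nat with (S m) by lia; reflexivity.
Qed.

Lemma smooth_continuous (f : R -> R) (x : R) : smooth f -> continuous f x.
Proof. intros Hf; apply @ex_derive_continuous, smooth_ex_derive, Hf. Qed.

Lemma smooth_ex_RInt (f : R -> R) (a b : R) : smooth f -> ex_RInt f a b.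
Proof.
intros Hf; apply @ex_RInt_continuous; intros z _; apply smooth_continuous, Hf.
Qed.

Lemma periodic_Derive_n (L : R) (f : R -> R) (k : nat) :
  periodic L f -> periodic L (Derive_n f k).
Proof.
intros Hf x.
rewrite <- (Derive_n_comp_trans f k x L); apply Derive_n_ext; exact Hf.
Qed.

Lemma periodic_Derive (L : R) (f : R -> R) :
  periodic L f -> periodic L (Derive f).
Proof. exact (periodic_Derive_n L f 1). Qed.

Lemma RInt_Derive_periodic (L : R) (f : R -> R) :
  smooth f -> periodic L f -> RInt (Derive f) 0 L = 0.
Proof.
intros Hf Hp.
rewrite RInt_Derive.
- generalize (Hp 0); rewrite Rplus_0_l; lra.
- intros x _; apply smooth_ex_derive, Hf.
- intros x _; apply smooth_continuous, (smooth_Derive_n f 1 Hf).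
Qed.

Lemma RInt_smooth_plus (f g : R -> R) (a b : R) : smooth f -> smooth g ->
  RInt (fun x => f x + g x) a b = RInt f a b + RInt g a b.
Proof. intros; apply @RInt_plus; apply smooth_ex_RInt; assumption. Qed.

Lemma RInt_smooth_scal (c : R) (f : R -> R) (a b : R) : smooth f ->
  RInt (fun x => c * f x) a b = c * RInt f a b.
Proof. intros; apply @RInt_scal, smooth_ex_RInt; assumption. Qed.

(* (ad(X)^T Y + ad(Y)^T X - ad(X) Y) / 2, with the adjoint
   ad(h, a)^T (k, b) = (2 h' k + h k' + b h''', 0). *)
Definition lc (L : R) (X Y : vir) : vir :=
  (fun x : R =>
     Derive (fst X) x * fst Y x + 2 * (fst X x * Derive (fst Y) x)
     + (/ 2 * snd Y * Derive_n (fst X) 3 x + / 2 * snd X * Derive_n (fst Y) 3 x),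
   - / 2 * omega L (fst X) (fst Y)).

Lemma smooth_Derive (f : R -> R) : smooth f -> smooth (Derive f).
Proof. exact (smooth_Derive_n f 1). Qed.

Ltac solve_smooth :=
  lazymatch goal with
  | |- smooth (fun x => @?f x + @?g x) =>
      apply (smooth_plus f g); cbv beta; solve_smooth
  | |- smooth (fun x => @?f x * @?g x) =>
      apply (smooth_mult f g); cbv beta; solve_smooth
  | |- smooth (fun _ => ?c) => exact (smooth_const c)
  | |- smooth (fun x => Derive_n ?f ?n x) =>
      apply (smooth_Derive_n f n); solve_smooth
  | |- smooth (Derive_n ?f ?n) => apply (smooth_Derive_n f n); solve_smooth
  | |- smooth (fun x => Derive ?f x) => apply (smooth_Derive f); solve_smooth
  | |- smooth (Derive ?f) => apply (smooth_Derive f); solve_smooth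
  | |- _ => assumption
  end.

Lemma lc_in_vir (L : R) (X Y : vir) :
  in_vir L X -> in_vir L Y -> in_vir L (lc L X Y).
Proof.
intros [HX PX] [HY PY]; split; cbn [lc fst snd].
- solve_smooth.
- intros x; cbv beta.
  rewrite (periodic_Derive L _ PX x), (periodic_Derive L _ PY x),
    (periodic_Derive_n L _ 3 PX x), (periodic_Derive_n L _ 3 PY x), PX, PY.
  reflexivity.
Qed.

Lemma omega_antisym (L : R) (h k : R -> R) :
  smooth h -> periodic L h -> smooth k -> periodic L k ->
  omega L h k = - omega L k h.
Proof.
intros Hh Ph Hk Pk; unfold omega.
assert (E : RInt (Derive (fun x => Derive h x * Derive k x)) 0 L = 0).
{ apply RInt_Derive_periodic; [solve_smooth|].
  intros x; cbv beta.
  rewrite (periodic_Derive L h Ph x), (periodic_Derive L k Pk x); reflexivity. }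
rewrite (RInt_ext _ (fun x => Derive h x * Derive_n k 2 x
                              + Derive k x * Derive_n h 2 x)) in E.
2:{ intros x _; rewrite Derive_mult by (apply smooth_ex_derive; solve_smooth).
    change (Derive_n h 2 x) with (Derive (Derive h) x).
    change (Derive_n k 2 x) with (Derive (Derive k) x).
    match goal with |- ?p = ?q => change (@eq R p q) end; ring. }
rewrite (RInt_smooth_plus (fun x => Derive h x * Derive_n k 2 x)
           (fun x => Derive k x * Derive_n h 2 x)) in E by solve_smooth.
lra.
Qed.

Lemma lc_metric (L : R) (X Y Z : vir) :
  in_vir L X -> in_vir L Y -> in_vir L Z ->
  inner L (lc L X Y) Z + inner L Y (lc L X Z) = 0.
Proof.
intros HX HY HZ.
assert (SXY := lc_in_vir L X Y HX HY); assert (SXZ := lc_in_vir L X Z HX HZ).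
destruct HX as [Hh Ph], HY as [Hk Pk], HZ as [Hl Pl], SXY as [S1 _], SXZ as [S2 _].
destruct X as [h a], Y as [k b], Z as [l c]; unfold inner.
cbn [fst snd] in *.
assert (D : forall f n, smooth f -> smooth (Derive_n f n))
  by (intros; apply smooth_Derive_n; assumption).
set (F := fun x => 2 * (h x * (k x * l x))
  + / 2 * a * (Derive_n k 2 x * l x + - 1 * (Derive k x * Derive l x)
               + k x * Derive_n l 2 x)
  + / 2 * b * (Derive_n h 2 x * l x + - 1 * (Derive h x * Derive l x))
  + / 2 * c * (Derive_n h 2 x * k x + - 1 * (Derive h x * Derive k x))).
assert (SF : smooth F).
{ unfold F; solve_smooth. }
assert (E : RInt (Derive F) 0 L = 0).
{ apply RInt_Derive_periodic; [exact SF|].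
  intros x; unfold F.
  rewrite (periodic_Derive L _ Ph x), (periodic_Derive L _ Pk x),
    (periodic_Derive L _ Pl x), (periodic_Derive_n L _ 2 Ph x),
    (periodic_Derive_n L _ 2 Pk x), (periodic_Derive_n L _ 2 Pl x), Ph, Pk, Pl.
  reflexivity. }
assert (DF : forall x, Derive F x =
  (fst (lc L (h, a) (k, b)) x * l x + k x * fst (lc L (h, a) (l, c)) x)
  + (- / 2 * c * (Derive h x * Derive_n k 2 x)
     + - / 2 * b * (Derive h x * Derive_n l 2 x))).
{ intros x; apply is_derive_unique.
  unfold F; auto_derive.
  - repeat split; apply smooth_ex_derive;
      first [solve_smooth | apply (D _ 2%nat); assumption].
  - simpl.
    change (fun x : R => h x) with h; change (fun x : R => k x) with k;
    change (fun x : R => l x) with l; change (fun x : R => Derive h x) with (Derive h);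
    change (fun x : R => Derive k x) with (Derive k);
    change (fun x : R => Derive l x) with (Derive l);
    change (fun x : R => Derive (Derive h) x) with (Derive (Derive h));
    change (fun x : R => Derive (Derive k) x) with (Derive (Derive k));
    change (fun x : R => Derive (Derive l) x) with (Derive (Derive l)).
    field. }
rewrite (RInt_ext _ _ _ _ (fun x _ => DF x)) in E.
rewrite (RInt_smooth_plus
    (fun x => fst (lc L (h, a) (k, b)) x * l x + k x * fst (lc L (h, a) (l, c)) x)
    (fun x => - / 2 * c * (Derive h x * Derive_n k 2 x)
              + - / 2 * b * (Derive h x * Derive_n l 2 x))),
  (RInt_smooth_plus (fun x => fst (lc L (h, a) (k, b)) x * l x)
    (fun x => k x * fst (lc L (h, a) (l, c)) x)),
  (RInt_smooth_plus (fun x => - / 2 * c * (Derive h x * Derive_n k 2 x))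
    (fun x => - / 2 * b * (Derive h x * Derive_n l 2 x))),
  (RInt_smooth_scal (- / 2 * c) (fun x => Derive h x * Derive_n k 2 x)),
  (RInt_smooth_scal (- / 2 * b) (fun x => Derive h x * Derive_n l 2 x)) in E
  by solve_smooth.
change (snd (lc L (h, a) (k, b))) with (- / 2 * omega L h k).
change (snd (lc L (h, a) (l, c))) with (- / 2 * omega L h l).
unfold omega; lra.
Qed.

Lemma levi_civita_exists (L : R) : exists Gamma, levi_civita L Gamma.
Proof.
exists (lc L); intros X Y HX HY.
split; [apply lc_in_vir; assumption|split].
- destruct HX, HY; unfold vminus, vplus, vopp, bracket, lc; simpl; f_equal.
  + apply functional_extensionality; intros x; ring.
  + rewrite (omega_antisym L (fst Y) (fst X)) by assumption. field.
- intros Z HZ; apply lc_metric; assumption.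
Qed.

(* Main.v *)
Require Import Defs.
From Stdlib Require Import Reals Lra FunctionalExtensionality.
From Coquelicot Require Import Coquelicot.
Open Scope R_scope.

(** A Levi-Civita connection on right invariant fields is unique (Koszul:
    [levi_civita_unique]), so [Gamma] may be replaced by the explicit [lc]; with
    it the geodesic equation [U_t = - lc U U] can be read off by components
    ([lc_diag], [geodesic_equations]).

    For the Jacobi equation, the covariant time derivative is expanded twice by
    the Leibniz rule ([is_vdt_lc]), which rests on the symmetry of mixed partial
    derivatives and on differentiation under the integral. Inserting the
    geodesic equation for [U_t], torsion freeness turns all second order terms
    in the connection into brackets ([jacobi_operator]): with [Q = [Y, U]] the
    field [Y] is Jacobi if and only if
    [Y_tt + 2 lc U Y_t - [Y, lc U U] + lc U Q + lc Q U = 0].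
    At a fixed time this involves space derivatives of products up to order
    three only, and its two components are the stated equations
    ([jacobi_spatial_fst], [jacobi_spatial_snd]). In the central one the
    contributions [omega (u, q)] and [omega (q, u)] of [Q = (q, _)] cancel.

    The momentum [b_t + omega (y, u)] is constant because its derivative
    [b_tt + omega (y_t, u) + omega (y, u_t)] vanishes by the equation for [b_tt]
    and the geodesic equation ([jacobi_momentum_constant]); integrating it
    from [t0], with [omega] integrated by parts, gives [b]. *)

(** * The Lie algebra *)

Lemma vir_ext (X Y : vir) :
  (forall x, fst X x = fst Y x) -> snd X = snd Y -> X = Y.
Proof.
destruct X, Y; simpl; intros H ->; f_equal; apply functional_extensionality, H.
Qed.

Lemma smooth_opp (f : R -> R) : smooth f -> smooth (fun x => - f x).
Proof.
intros Hf.
replace (fun x => - f x) with (fun x => -1 * f x)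
  by (apply functional_extensionality; intros; ring).
solve_smooth.
Qed.

Lemma smooth_minus (f g : R -> R) :
  smooth f -> smooth g -> smooth (fun x => f x - g x).
Proof.
intros Hf Hg; apply (smooth_plus f (fun x => - g x));
  [assumption | apply smooth_opp; assumption].
Qed.

Lemma in_vir_plus (L : R) (X Y : vir) :
  in_vir L X -> in_vir L Y -> in_vir L (vplus X Y).
Proof.
intros [SX PX] [SY PY]; split; simpl.
- solve_smooth.
- intros x; rewrite PX, PY; reflexivity.
Qed.

Lemma in_vir_opp (L : R) (X : vir) : in_vir L X -> in_vir L (vopp X).
Proof.
intros [SX PX]; split; simpl.
- apply smooth_opp; assumption.
- intros x; rewrite PX; reflexivity.
Qed.

Lemma in_vir_minus (L : R) (X Y : vir) :
  in_vir L X -> in_vir L Y -> in_vir L (vminus X Y).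
Proof.
intros HX HY; apply in_vir_plus; [|apply in_vir_opp]; assumption.
Qed.

Lemma in_vir_bracket (L : R) (X Y : vir) :
  in_vir L X -> in_vir L Y -> in_vir L (bracket L X Y).
Proof.
intros [SX PX] [SY PY]; split; simpl.
- apply smooth_minus; solve_smooth.
- intros x.
  rewrite (periodic_Derive L _ PX x), (periodic_Derive L _ PY x), PX, PY.
  reflexivity.
Qed.

Lemma inner_sym (L : R) (X Y : vir) : inner L X Y = inner L Y X.
Proof.
unfold inner; f_equal; [|ring].
apply RInt_ext; intros; apply Rmult_comm.
Qed.

Lemma inner_minus_l (L : R) (X Y Z : vir) :
  in_vir L X -> in_vir L Y -> in_vir L Z ->
  inner L (vminus X Y) Z = inner L X Z - inner L Y Z.
Proof.
intros [SX _] [SY _] [SZ _]; unfold inner; simpl.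
rewrite (RInt_ext _ (fun x => fst X x * fst Z x + -1 * (fst Y x * fst Z x)))
  by (intros; match goal with |- ?p = ?q => change (@eq R p q) end; ring).
rewrite (RInt_smooth_plus (fun x => fst X x * fst Z x)
  (fun x => -1 * (fst Y x * fst Z x))) by solve_smooth.
rewrite (RInt_smooth_scal (-1) (fun x => fst Y x * fst Z x)) by solve_smooth.
ring.
Qed.

(** The antiderivative [F] of [f ^ 2] is nondecreasing, and L-periodic because
    its increment over one period vanishes; so it is constant on every interval
    of length L, and its derivative is zero everywhere. *)
Lemma periodic_sqr_RInt_eq_0 (L : R) (f : R -> R) : 0 < L ->
  smooth f -> periodic L f -> RInt (fun x => f x * f x) 0 L = 0 ->
  forall x, f x = 0.
Proof.
intros HL Sf Pf H0.
set (g := fun x => f x * f x) in *.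
assert (Sg : smooth g) by (unfold g; solve_smooth).
set (F := (fun x => RInt g 0 x) : R -> R).
assert (DF : forall x, is_derive F x (g x)).
{ intros x; apply (is_derive_RInt g F 0 x).
  - apply filter_forall; intros y; exact (RInt_correct g 0 y (smooth_ex_RInt g 0 y Sg)).
  - apply smooth_continuous, Sg. }
assert (mono : forall p q, p <= q -> F p <= F q).
{ intros p q Hpq.
  replace (F q) with (F p + RInt g p q)
    by (apply (RInt_Chasles g 0 p q); apply smooth_ex_RInt, Sg).
  enough (0 <= RInt g p q) by lra.
  apply RInt_ge_0; [exact Hpq | apply smooth_ex_RInt, Sg |].
  intros x _; unfold g; nra. }
assert (per : forall x, F (x + L) = F x).
{ set (G := fun x => F (x + L) - F x).
  assert (DG : forall x, is_derive G x 0).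
  { intros x; unfold G.
    replace 0 with (g (x + L) - g x) by (unfold g; rewrite Pf; ring).
    apply (is_derive_minus (fun y => F (y + L)) F); [|apply DF].
    replace (g (x + L)) with (scal 1 (g (x + L))) by apply (scal_one (g (x + L))).
    apply (is_derive_comp F (fun y => y + L)); [apply DF|].
    auto_derive; [exact I | ring]. }
  assert (G0 : G 0 = 0).
  { unfold G, F; rewrite Rplus_0_l, H0, (RInt_point 0 g).
    change (0 - 0 = 0); ring. }
  intros x; enough (G x = 0) by (unfold G in *; lra).
  rewrite <- G0.
  destruct (Rtotal_order x 0) as [h|[->|h]]; [|reflexivity|].
  - apply (eq_is_derive G); [intros; apply DG | exact h].
  - symmetry; apply (eq_is_derive G); [intros; apply DG | exact h]. }
assert (cst : forall x y, x <= y <= x + L -> F y = F x).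
{ intros x y [h1 h2]; apply Rle_antisym; [|apply mono, h1].
  rewrite <- (per x); apply mono, h2. }
intros x.
assert (D0 : is_derive F x 0).
{ apply (is_derive_ext_loc (fun _ => F x)).
  - exists (mkposreal L HL); intros y Hy.
    apply Rabs_lt_between' in Hy; simpl in Hy.
    destruct (Rle_dec x y); [symmetry|]; apply cst; lra.
  - apply @is_derive_const. }
assert (E : g x = 0)
  by (rewrite <- (is_derive_unique _ _ _ (DF x)); apply is_derive_unique, D0).
unfold g in E; nra.
Qed.

Lemma inner_definite (L : R) (X : vir) : 0 < L -> in_vir L X ->
  inner L X X = 0 -> X = vzero.
Proof.
intros HL [SX PX] H; unfold inner in H.
assert (0 <= RInt (fun x => fst X x * fst X x) 0 L).
{ apply RInt_ge_0; [lra | apply smooth_ex_RInt; solve_smooth |].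
  intros; nra. }
apply vir_ext; simpl; [|nra].
apply (periodic_sqr_RInt_eq_0 L); try assumption; nra.
Qed.

(** * The Levi-Civita connection *)

(** Koszul: the difference [D X Y Z] of the two values of
    [inner (nabla X Y) Z] is symmetric in [X, Y] and antisymmetric in [Y, Z],
    and an expression with both properties vanishes. *)
Lemma levi_civita_unique (L : R) (G G' : vir -> vir -> vir) : 0 < L ->
  levi_civita L G -> levi_civita L G' ->
  forall X Y, in_vir L X -> in_vir L Y -> G X Y = G' X Y.
Proof.
intros HL HG HG'.
set (D := fun X Y Z => inner L (G X Y) Z - inner L (G' X Y) Z).
assert (sym : forall X Y Z, in_vir L X -> in_vir L Y -> in_vir L Z ->
  D X Y Z = D Y X Z).
{ intros X Y Z HX HY HZ; unfold D.
  destruct (HG X Y HX HY) as [I1 [T1 _]], (HG Y X HY HX) as [I2 _].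
  destruct (HG' X Y HX HY) as [I3 [T2 _]], (HG' Y X HY HX) as [I4 _].
  rewrite <- T2 in T1.
  assert (E := f_equal (fun V => inner L V Z) T1); cbv beta in E.
  rewrite !inner_minus_l in E by assumption; lra. }
assert (anti : forall X Y Z, in_vir L X -> in_vir L Y -> in_vir L Z ->
  D X Y Z = - D X Z Y).
{ intros X Y Z HX HY HZ; unfold D.
  destruct (HG X Y HX HY) as [_ [_ M]], (HG' X Y HX HY) as [_ [_ M']].
  specialize (M Z HZ); specialize (M' Z HZ).
  rewrite (inner_sym L Y) in M, M'; lra. }
intros X Y HX HY.
destruct (HG X Y HX HY) as [I1 _], (HG' X Y HX HY) as [I2 _].
set (Z := vminus (G X Y) (G' X Y)).
assert (HZ : in_vir L Z) by (apply in_vir_minus; assumption).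
(* Six alternating applications of the two symmetries give
   D X Y Z = - D X Y Z. *)
assert (DZ : D X Y Z = 0).
{ assert (H1 := anti X Y Z HX HY HZ); assert (H2 := sym X Z Y HX HZ HY).
  assert (H3 := anti Z X Y HZ HX HY); assert (H4 := sym Z Y X HZ HY HX).
  assert (H5 := anti Y Z X HY HZ HX); assert (H6 := sym Y X Z HY HX HZ). lra. }
assert (E : Z = vzero).
{ apply (inner_definite L); [exact HL | exact HZ |].
  unfold Z at 1; rewrite inner_minus_l by assumption; exact DZ. }
apply vir_ext.
- intros x; assert (E1 := f_equal (fun V : vir => fst V x) E); simpl in E1; lra.
- assert (E1 := f_equal snd E); simpl in E1; lra.
Qed.

Lemma lc_torsion (L : R) (X Y : vir) : in_vir L X -> in_vir L Y ->
  vminus (lc L X Y) (lc L Y X) = vopp (bracket L X Y).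
Proof.
intros [SX PX] [SY PY]; apply vir_ext; simpl.
- intros x; ring.
- rewrite (omega_antisym L (fst Y) (fst X)) by assumption; field.
Qed.

Lemma levi_civita_lc (L : R) : levi_civita L (lc L).
Proof.
intros X Y HX HY; split; [|split].
- apply lc_in_vir; assumption.
- apply lc_torsion; assumption.
- intros Z HZ; apply lc_metric; assumption.
Qed.

(** * The cocycle *)

Lemma Derive_smooth_plus (f g : R -> R) (x : R) : smooth f -> smooth g ->
  Derive (fun y => f y + g y) x = Derive f x + Derive g x.
Proof. intros; apply Derive_plus; apply smooth_ex_derive; assumption. Qed.

Lemma Derive_n_smooth_plus (f g : R -> R) (n : nat) (x : R) :
  smooth f -> smooth g ->
  Derive_n (fun y => f y + g y) n x = Derive_n f n x + Derive_n g n x.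
Proof.
intros Sf Sg; apply Derive_n_plus; apply filter_forall; intros y k _;
  [apply Sf | apply Sg].
Qed.

Lemma omega_plus_r (L : R) (h k l : R -> R) :
  smooth h -> smooth k -> smooth l ->
  omega L h (fun x => k x + l x) = omega L h k + omega L h l.
Proof.
intros Sh Sk Sl; unfold omega.
rewrite <- RInt_smooth_plus by solve_smooth.
apply RInt_ext; intros x _.
rewrite Derive_n_smooth_plus by assumption.
match goal with |- ?p = ?q => change (@eq R p q) end; ring.
Qed.

Lemma omega_scal_r (L c : R) (h k : R -> R) : smooth h -> smooth k ->
  omega L h (fun x => c * k x) = c * omega L h k.
Proof.
intros Sh Sk; unfold omega.
rewrite <- RInt_smooth_scal by solve_smooth.
apply RInt_ext; intros x _.
rewrite Derive_n_scal_l.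
match goal with |- ?p = ?q => change (@eq R p q) end; ring.
Qed.

Lemma omega_diag (L : R) (h : R -> R) : smooth h -> periodic L h ->
  omega L h h = 0.
Proof. intros Sh Ph; assert (E := omega_antisym L h h Sh Ph Sh Ph); lra. Qed.

(** [h' k'' - h''' k] is the derivative of [h' k' - h'' k]. *)
Lemma omega_by_parts (L : R) (h k : R -> R) :
  smooth h -> periodic L h -> smooth k -> periodic L k ->
  omega L h k = RInt (fun x => Derive_n h 3 x * k x) 0 L.
Proof.
intros Sh Ph Sk Pk; unfold omega.
set (F := fun x => Derive h x * Derive k x + -1 * (Derive_n h 2 x * k x)).
assert (SF : smooth F) by (unfold F; solve_smooth).
assert (E : RInt (Derive F) 0 L = 0).
{ apply RInt_Derive_periodic; [exact SF|].
  intros x; unfold F.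
  rewrite (periodic_Derive L _ Ph x), (periodic_Derive L _ Pk x),
    (periodic_Derive_n L _ 2 Ph x), Pk; reflexivity. }
rewrite (RInt_ext _ (fun x => Derive h x * Derive_n k 2 x
                              + -1 * (Derive_n h 3 x * k x))) in E.
2:{ intros x _; unfold F.
    rewrite Derive_smooth_plus by solve_smooth.
    rewrite Derive_scal, !Derive_mult by (apply smooth_ex_derive; solve_smooth).
    change (Derive_n h 3 x) with (Derive (Derive_n h 2) x).
    change (Derive_n k 2 x) with (Derive (Derive k) x).
    change (Derive_n h 2 x) with (Derive (Derive h) x).
    match goal with |- ?p = ?q => change (@eq R p q) end; ring. }
rewrite (RInt_smooth_plus (fun x => Derive h x * Derive_n k 2 x)
  (fun x => -1 * (Derive_n h 3 x * k x))) in E by solve_smooth.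
rewrite (RInt_smooth_scal (-1) (fun x => Derive_n h 3 x * k x)) in E
  by solve_smooth.
lra.
Qed.

Lemma lc_plus_r (L : R) (X Y Z : vir) :
  in_vir L X -> in_vir L Y -> in_vir L Z ->
  lc L X (vplus Y Z) = vplus (lc L X Y) (lc L X Z).
Proof.
intros [SX _] [SY _] [SZ _]; apply vir_ext; cbn [lc vplus fst snd].
- intros x; rewrite Derive_smooth_plus, Derive_n_smooth_plus by assumption.
  field.
- rewrite omega_plus_r by assumption; ring.
Qed.

Lemma lc_opp_l (L : R) (X Y : vir) : in_vir L X -> in_vir L Y ->
  lc L (vopp X) Y = vopp (lc L X Y).
Proof.
intros [SX PX] [SY PY].
assert (SN := smooth_opp _ SX).
assert (PN : periodic L (fun x => - fst X x))
  by (intros x; rewrite PX; reflexivity).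
apply vir_ext; cbn [lc vopp fst snd].
- intros x; rewrite Derive_opp, Derive_n_opp; ring.
- rewrite (omega_antisym L (fun x => - fst X x) (fst Y)),
    (omega_antisym L (fst X) (fst Y))
    by assumption.
  replace (fun x => - fst X x) with (fun x => -1 * fst X x)
    by (apply functional_extensionality; intros; ring).
  rewrite omega_scal_r by assumption; ring.
Qed.

(** * Smooth fields on I x S^1 *)

Lemma Ck2_dt (I : R -> Prop) (f : R -> R -> R) :
  (forall n, Ck2 I n f) -> forall n, Ck2 I n (dt f).
Proof. intros H n; destruct (H (S n)) as [_ [_ [H1 _]]]; exact H1. Qed.

Lemma Ck2_dx (I : R -> Prop) (f : R -> R -> R) (k : nat) :
  (forall n, Ck2 I n f) -> forall n, Ck2 I n (dx k f).
Proof.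
intros H; induction k as [|k IH]; [exact H|].
intros n; destruct (IH (S n)) as [_ [_ [_ H1]]]; exact H1.
Qed.

Lemma Ck2_continuity (I : R -> Prop) (f : R -> R -> R) :
  (forall n, Ck2 I n f) -> forall t x, I t -> continuity_2d_pt f t x.
Proof. intros H; exact (proj1 (H 0%nat)). Qed.

Lemma Ck2_ex_dt (I : R -> Prop) (f : R -> R -> R) :
  (forall n, Ck2 I n f) ->
  forall t x, I t -> ex_derive (fun s => f s x) t.
Proof. intros H t x Ht; apply (proj1 (proj2 (H 1%nat)) t x Ht). Qed.

Lemma Ck2_smooth (I : R -> Prop) (f : R -> R -> R) :
  (forall n, Ck2 I n f) -> forall t, I t -> smooth (f t).
Proof.
intros H t Ht [|n] x; [exact Logic.I|].
exact (proj2 (proj1 (proj2 (Ck2_dx I f n H 1%nat)) t x Ht)).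
Qed.

Lemma open_locally_2d (I : R -> Prop) (P : R -> R -> Prop) (t x : R) :
  open I -> I t -> (forall s z, I s -> P s z) -> locally_2d P t x.
Proof.
intros HI Ht HP; destruct (HI t Ht) as [d Hd].
exists d; intros s z Hs _; apply HP, Hd, Hs.
Qed.

(** Schwarz's theorem, applied once per space derivative. *)
Lemma dt_dx (I : R -> Prop) (f : R -> R -> R) : open I ->
  (forall n, Ck2 I n f) ->
  forall n t x, I t -> dt (dx n f) t x = dx n (dt f) t x.
Proof.
intros HI Hf n; induction n as [|n IH]; intros t x Ht; [reflexivity|].
assert (Hg := Ck2_dx I f n Hf).
transitivity (dx 1 (dt (dx n f)) t x).
- apply (Schwarz (dx n f) t x).
  + apply (open_locally_2d I); [exact HI | exact Ht |].
    intros s z Hs; repeat split.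
    * apply (Ck2_ex_dt I _ Hg s z Hs).
    * exact (Ck2_smooth I _ Hg s Hs 1%nat z).
    * apply (Ck2_ex_dt I _ (Ck2_dx I _ 1 Hg) s z Hs).
    * exact (Ck2_smooth I _ (Ck2_dt I _ Hg) s Hs 1%nat z).
  + exact (Ck2_continuity I _ (Ck2_dt I _ (Ck2_dx I _ 1 Hg)) t x Ht).
  + exact (Ck2_continuity I _ (Ck2_dx I _ 1 (Ck2_dt I _ Hg)) t x Ht).
- unfold dx; simpl; apply Derive_ext; intros z; exact (IH t z Ht).
Qed.

Lemma smooth_field_dt (L : R) (I : R -> Prop) (f : R -> R -> R) : open I ->
  smooth_field L I f -> smooth_field L I (dt f).
Proof.
intros HI [Hf Pf]; split; [apply Ck2_dt, Hf|].
intros t Ht x; apply Derive_ext_loc.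
generalize (HI t Ht); apply filter_imp; intros s Hs; apply Pf, Hs.
Qed.

Lemma is_derive_dx (L : R) (I : R -> Prop) (f : R -> R -> R) : open I ->
  smooth_field L I f -> forall n t x, I t ->
  is_derive (fun s => dx n f s x) t (dx n (dt f) t x).
Proof.
intros HI [Hf _] n t x Ht.
rewrite <- (dt_dx I f HI Hf n t x Ht).
apply Derive_correct, (Ck2_ex_dt I _ (Ck2_dx I f n Hf) t x Ht).
Qed.

Lemma smooth_field_in_vir (L : R) (I : R -> Prop) (f : R -> R -> R)
    (t c : R) : smooth_field L I f -> I t -> in_vir L (f t, c).
Proof. intros [Hf Pf] Ht; split; [apply (Ck2_smooth I f Hf t Ht) | apply Pf, Ht]. Qed.

Lemma is_derive_omega (L : R) (I : R -> Prop) (f g : R -> R -> R) : open I ->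
  smooth_field L I f -> smooth_field L I g -> forall t, I t ->
  is_derive (fun s => omega L (f s) (g s)) t
    (omega L (dt f t) (g t) + omega L (f t) (dt g t)).
Proof.
intros HI Hf Hg t Ht.
set (F := fun s x => dx 1 f s x * dx 2 g s x).
set (F' := fun s x => dx 1 (dt f) s x * dx 2 g s x
                      + dx 1 f s x * dx 2 (dt g) s x).
assert (DF : forall s x, I s -> is_derive (fun r => F r x) s (F' s x)).
{ intros s x Hs; apply (is_derive_mult (fun r => dx 1 f r x) (fun r => dx 2 g r x)).
  - apply (is_derive_dx L I f HI Hf 1 s x Hs).
  - apply (is_derive_dx L I g HI Hg 2 s x Hs).
  - intros; apply Rmult_comm. }
assert (Hf' := smooth_field_dt L I f HI Hf).
assert (Hg' := smooth_field_dt L I g HI Hg).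
assert (sm : forall s, I s -> smooth (F s)).
{ intros s Hs; assert (Sf := Ck2_smooth I f (proj1 Hf) s Hs);
    assert (Sg := Ck2_smooth I g (proj1 Hg) s Hs); unfold F, dx; solve_smooth. }
assert (near : locally t I) by exact (HI t Ht).
replace (omega L (dt f t) (g t) + omega L (f t) (dt g t))
  with (RInt (fun x => Derive (fun s => F s x) t) 0 L).
- apply (is_derive_RInt_param F 0 L t).
  + revert near; apply filter_imp; intros s Hs x _.
    exists (F' s x); apply DF, Hs.
  + intros x _; apply (continuity_2d_pt_ext_loc F').
    * apply (open_locally_2d I); [exact HI | exact Ht |].
      intros s z Hs; symmetry; apply is_derive_unique, DF, Hs.
    * apply continuity_2d_pt_plus; apply continuity_2d_pt_mult;
        apply (Ck2_continuity I); try exact Ht; apply Ck2_dx;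
        first [apply Hf | apply Hf' | apply Hg | apply Hg'].
  + revert near; apply filter_imp; intros s Hs.
    apply smooth_ex_RInt, sm, Hs.
- assert (Sf := Ck2_smooth I f (proj1 Hf) t Ht).
  assert (Sg := Ck2_smooth I g (proj1 Hg) t Ht).
  assert (Sf' := Ck2_smooth I _ (proj1 Hf') t Ht).
  assert (Sg' := Ck2_smooth I _ (proj1 Hg') t Ht).
  unfold omega; rewrite <- RInt_smooth_plus by solve_smooth.
  apply RInt_ext; intros x _.
  apply is_derive_unique, DF, Ht.
Qed.

(** * Curves in the Lie algebra *)

Definition smooth_curve (L : R) (I : R -> Prop) (Y : R -> vir) : Prop :=
  smooth_field L I (fun t => fst (Y t)) /\ smooth_on I (fun t => snd (Y t)).

(** The values of [vdt] are defined without any differentiability; this relation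
    also asserts that both components are differentiable in time. *)
Definition is_vdt (Y : R -> vir) (t : R) (V : vir) : Prop :=
  (forall x, is_derive (fun s => fst (Y s) x) t (fst V x)) /\
  is_derive (fun s => snd (Y s)) t (snd V).

Lemma is_vdt_unique (Y : R -> vir) (t : R) (V : vir) :
  is_vdt Y t V -> vdt Y t = V.
Proof.
intros [H1 H2]; apply vir_ext; [intros x|]; apply is_derive_unique;
  [apply H1 | apply H2].
Qed.

Lemma is_vdt_ext_loc (Y Z : R -> vir) (t : R) (V : vir) :
  locally t (fun s => Y s = Z s) -> is_vdt Y t V -> is_vdt Z t V.
Proof.
intros E [H1 H2]; split; [intros x|]; eapply is_derive_ext_loc;
  try (apply H1 || apply H2);
  revert E; apply filter_imp; intros s ->; reflexivity.
Qed.

Lemma is_vdt_plus (Y Z : R -> vir) (t : R) (V W : vir) :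
  is_vdt Y t V -> is_vdt Z t W ->
  is_vdt (fun s => vplus (Y s) (Z s)) t (vplus V W).
Proof.
intros [H1 H2] [K1 K2]; split; [intros x|].
- apply (is_derive_plus (fun s => fst (Y s) x) (fun s => fst (Z s) x)); auto.
- apply (is_derive_plus (fun s => snd (Y s)) (fun s => snd (Z s))); auto.
Qed.

Lemma smooth_on_Derive (I : R -> Prop) (f : R -> R) :
  smooth_on I f -> smooth_on I (Derive f).
Proof.
intros Hf [|n] t Ht; [exact Logic.I|].
generalize (Hf (S (S n)) t Ht); apply ex_derive_ext; intros s.
transitivity (Derive_n f (n + 1) s);
  [rewrite Nat.add_1_r; reflexivity | symmetry; apply (Derive_n_comp f n 1)].
Qed.

Lemma smooth_curve_vdt (L : R) (I : R -> Prop) (Y : R -> vir) : open I ->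
  smooth_curve L I Y -> smooth_curve L I (vdt Y).
Proof.
intros HI [H1 H2]; split.
- exact (smooth_field_dt L I _ HI H1).
- exact (smooth_on_Derive I _ H2).
Qed.

Lemma smooth_curve_in_vir (L : R) (I : R -> Prop) (Y : R -> vir) (t : R) :
  smooth_curve L I Y -> I t -> in_vir L (Y t).
Proof.
intros [H _] Ht.
(* Membership depends on the vector field part only, so the central value 0
   may stand for snd (Y t). *)
exact (smooth_field_in_vir L I _ t 0 H Ht).
Qed.

Lemma smooth_curve_is_vdt (L : R) (I : R -> Prop) (Y : R -> vir) (t : R) :
  smooth_curve L I Y -> I t -> is_vdt Y t (vdt Y t).
Proof.
intros [[H1 _] H2] Ht; split; [intros x|]; apply Derive_correct.
- exact (Ck2_ex_dt I _ H1 t x Ht).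
- exact (H2 1%nat t Ht).
Qed.

(** The Leibniz rule in time for the connection. It commutes the time
    derivative with the space derivatives and with the integral over the
    circle in the central component. *)
Lemma is_vdt_lc (L : R) (I : R -> Prop) (X Y : R -> vir) (t : R) : open I ->
  smooth_curve L I X -> smooth_curve L I Y -> I t ->
  is_vdt (fun s => lc L (X s) (Y s)) t
    (vplus (lc L (vdt X t) (Y t)) (lc L (X t) (vdt Y t))).
Proof.
intros HI HX HY Ht.
destruct (smooth_curve_is_vdt L I X t HX Ht) as [_ DX].
destruct (smooth_curve_is_vdt L I Y t HY Ht) as [_ DY].
destruct HX as [HX _], HY as [HY _].
assert (DX0 : forall n x, is_derive (fun s => Derive_n (fst (X s)) n x) t
                            (Derive_n (fst (vdt X t)) n x))
  by (intros n x; exact (is_derive_dx L I _ HI HX n t x Ht)).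
assert (DY0 : forall n x, is_derive (fun s => Derive_n (fst (Y s)) n x) t
                            (Derive_n (fst (vdt Y t)) n x))
  by (intros n x; exact (is_derive_dx L I _ HI HY n t x Ht)).
assert (M : forall p q p' q', is_derive p t p' -> is_derive q t q' ->
  is_derive (fun s => p s * q s) t (p' * q t + p t * q')).
{ intros p q p' q' Hp Hq; apply (is_derive_mult p q t p' q' Hp Hq).
  intros; apply Rmult_comm. }
assert (P : forall p q p' q', is_derive p t p' -> is_derive q t q' ->
  is_derive (fun s => p s + q s) t (p' + q'))
  by (intros; apply (is_derive_plus p q); assumption).
assert (C : forall c p p', is_derive p t p' ->
  is_derive (fun s => c * p s) t (c * p'))
  by (intros; apply is_derive_scal; assumption).
split.
- intros x.
  assert (DX1 : is_derive (fun s => Derive (fst (X s)) x) t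
                  (Derive (fst (vdt X t)) x)) by exact (DX0 1%nat x).
  assert (DY1 : is_derive (fun s => Derive (fst (Y s)) x) t
                  (Derive (fst (vdt Y t)) x)) by exact (DY0 1%nat x).
  assert (E := P _ _ _ _
    (P _ _ _ _ (M _ _ _ _ DX1 (DY0 0%nat x))
                (C 2 _ _ (M _ _ _ _ (DX0 0%nat x) DY1)))
    (P _ _ _ _ (M _ _ _ _ (C (/ 2) _ _ DY) (DX0 3%nat x))
                (M _ _ _ _ (C (/ 2) _ _ DX) (DY0 3%nat x)))).
  match type of E with is_derive _ _ ?v =>
    match goal with |- is_derive _ _ ?w => replace w with v; [exact E|] end end.
  cbn [lc vplus fst snd Derive_n]; ring.
- cbn [lc vplus fst snd].
  rewrite <- Rmult_plus_distr_l.
  apply (is_derive_scal (fun s => omega L (fst (X s)) (fst (Y s)))).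
  exact (is_derive_omega L I _ _ HI HX HY t Ht).
Qed.

(** * The Jacobi operator *)

Lemma second_cov_dt (L : R) (Gamma : vir -> vir -> vir) (I : R -> Prop)
    (U Y : R -> vir) (t : R) : 0 < L -> levi_civita L Gamma -> open I ->
  smooth_curve L I U -> smooth_curve L I Y -> I t ->
  cov_dt Gamma U (cov_dt Gamma U Y) t =
    vplus (vplus (vdt (vdt Y) t)
                 (vplus (lc L (vdt U t) (Y t)) (lc L (U t) (vdt Y t))))
          (vplus (lc L (U t) (vdt Y t)) (lc L (U t) (lc L (U t) (Y t)))).
Proof.
intros HL HG HI HU HY Ht.
assert (E := levi_civita_unique L _ _ HL HG (levi_civita_lc L)).
assert (in_U := fun s => smooth_curve_in_vir L I U s HU).
assert (in_Y := fun s => smooth_curve_in_vir L I Y s HY).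
assert (HY' := smooth_curve_vdt L I Y HI HY).
assert (in_Y' := smooth_curve_in_vir L I _ t HY' Ht).
assert (cov : forall s, I s ->
  vplus (vdt Y s) (lc L (U s) (Y s)) = cov_dt Gamma U Y s)
  by (intros s Hs; unfold cov_dt; rewrite E by auto; reflexivity).
unfold cov_dt at 1; f_equal.
- apply is_vdt_unique.
  apply (is_vdt_ext_loc (fun s => vplus (vdt Y s) (lc L (U s) (Y s)))).
  + generalize (HI t Ht); apply filter_imp, cov.
  + apply is_vdt_plus; [exact (smooth_curve_is_vdt L I _ t HY' Ht)|].
    apply (is_vdt_lc L I); assumption.
- rewrite <- (cov t Ht).
  assert (in_lc : in_vir L (lc L (U t) (Y t))) by (apply lc_in_vir; auto).
  rewrite E by (auto; apply in_vir_plus; assumption).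
  apply lc_plus_r; auto.
Qed.

(** Torsion freeness is used twice. The terms [lc Y (lc U U)] of the curvature
    and [lc U_t Y = - lc (lc U U) Y] combine into [- [Y, lc U U]], and the terms
    [lc U (lc U Y)] and [- lc U (lc Y U)] into [lc U Q]. *)
Lemma jacobi_operator (L : R) (Gamma : vir -> vir -> vir) (I : R -> Prop)
    (U Y : R -> vir) (t : R) : 0 < L -> levi_civita L Gamma -> open I ->
  smooth_curve L I U -> smooth_curve L I Y -> geodesic Gamma I U -> I t ->
  let Q := bracket L (Y t) (U t) in
  vplus (cov_dt Gamma U (cov_dt Gamma U Y) t)
        (curvature L Gamma (Y t) (U t) (U t)) =
  vplus (vplus (vdt (vdt Y) t)
               (vplus (lc L (U t) (vdt Y t)) (lc L (U t) (vdt Y t))))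
        (vplus (vopp (bracket L (Y t) (lc L (U t) (U t))))
               (vplus (lc L (U t) Q) (lc L Q (U t)))).
Proof.
intros HL HG HI HU HY Hgeo Ht Q.
assert (E := levi_civita_unique L _ _ HL HG (levi_civita_lc L)).
assert (in_U := smooth_curve_in_vir L I U t HU Ht).
assert (in_Y := smooth_curve_in_vir L I Y t HY Ht).
assert (in_Q : in_vir L Q) by (apply in_vir_bracket; assumption).
rewrite (second_cov_dt L Gamma I) by assumption.
assert (U' : vdt U t = vopp (lc L (U t) (U t))).
{ assert (H := Hgeo t Ht); unfold cov_dt in H; rewrite E in H by assumption.
  apply vir_ext; simpl.
  - intros x; assert (H1 := f_equal (fun V : vir => fst V x) H); simpl in H1; lra.
  - assert (H1 := f_equal snd H); simpl in H1; lra. }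
rewrite U'; unfold curvature.
set (u := U t) in *; set (y := Y t) in *; fold Q.
assert (in_W : in_vir L (lc L u u)) by (apply lc_in_vir; assumption).
assert (in_YU : in_vir L (lc L y u)) by (apply lc_in_vir; assumption).
assert (in_UY : in_vir L (lc L u y)) by (apply lc_in_vir; assumption).
rewrite (E u u), (E y u), (E y (lc L u u)), (E u (lc L y u)), (E Q u)
  by assumption.
set (W := lc L u u) in *.
assert (T1 := lc_torsion L y W in_Y in_W).
assert (T2 : lc L u Q = vminus (lc L u (lc L u y)) (lc L u (lc L y u))).
{ assert (Hu : lc L u y = vplus Q (lc L y u)).
  { assert (T := lc_torsion L y u in_Y in_U).
    apply vir_ext.
    - intros x; assert (T3 := f_equal (fun V : vir => fst V x) T).
      unfold Q; simpl in T3 |- *; lra.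
    - assert (T3 := f_equal snd T); unfold Q; simpl in T3 |- *; lra. }
  rewrite Hu, lc_plus_r by assumption.
  apply vir_ext; simpl; intros; ring. }
rewrite lc_opp_l by assumption.
rewrite T2, <- T1.
apply vir_ext; unfold vplus, vminus, vopp; simpl fst; simpl snd; intros; ring.
Qed.

(** * The components *)

Lemma Derive_wronskian (f g p q : R -> R) (x : R) :
  smooth f -> smooth g -> smooth p -> smooth q ->
  Derive (fun x => f x * g x - p x * q x) x =
    Derive f x * g x + f x * Derive g x
    - (Derive p x * q x + p x * Derive q x).
Proof.
intros Sf Sg Sp Sq.
rewrite Derive_minus, !Derive_mult; try reflexivity;
  apply smooth_ex_derive; solve_smooth.
Qed.

Lemma Derive_bracket (h k : R -> R) : smooth h -> smooth k ->
  Derive (fun x => Derive k x * h x - k x * Derive h x) =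
  (fun x => Derive_n k 2 x * h x - k x * Derive_n h 2 x).
Proof.
intros Sh Sk; apply functional_extensionality; intros x.
rewrite Derive_wronskian by solve_smooth.
change (Derive_n k 2 x) with (Derive (Derive k) x).
change (Derive_n h 2 x) with (Derive (Derive h) x).
ring.
Qed.

(** In the third derivative of [k' h - k h'] the terms [k'' h''] cancel. *)
Lemma Derive_n_3_bracket (h k : R -> R) (x : R) : smooth h -> smooth k ->
  Derive_n (fun x => Derive k x * h x - k x * Derive h x) 3 x =
    Derive_n k 4 x * h x + 2 * (Derive_n k 3 x * Derive h x)
    - 2 * (Derive k x * Derive_n h 3 x) - k x * Derive_n h 4 x.
Proof.
intros Sh Sk.
change (Derive (Derive (Derive
  (fun x => Derive k x * h x - k x * Derive h x))) x = 
    Derive_n k 4 x * h x + 2 * (Derive_n k 3 x * Derive h x)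
    - 2 * (Derive k x * Derive_n h 3 x) - k x * Derive_n h 4 x).
rewrite Derive_bracket by assumption.
rewrite (functional_extensionality _ (fun x =>
  (Derive_n k 3 x * h x + Derive_n k 2 x * Derive h x)
  - (Derive k x * Derive_n h 2 x + k x * Derive_n h 3 x))
  (fun z => Derive_wronskian (Derive_n k 2) h k (Derive_n h 2) z
    (smooth_Derive_n k 2 Sk) Sh Sk (smooth_Derive_n h 2 Sh))).
rewrite Derive_minus by (apply smooth_ex_derive; solve_smooth).
rewrite !Derive_smooth_plus by solve_smooth.
rewrite !Derive_mult by (apply smooth_ex_derive; solve_smooth).
change (Derive_n k 4 x) with (Derive (Derive_n k 3) x).
change (Derive_n k 3 x) with (Derive (Derive_n k 2) x).
change (Derive_n k 2 x) with (Derive (Derive k) x).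
change (Derive_n h 4 x) with (Derive (Derive_n h 3) x).
change (Derive_n h 3 x) with (Derive (Derive_n h 2) x).
change (Derive_n h 2 x) with (Derive (Derive h) x).
ring.
Qed.

Lemma lc_diag (L a : R) (h : R -> R) : smooth h -> periodic L h ->
  lc L (h, a) (h, a) =
  (fun x => 3 * Derive h x * h x + a * Derive_n h 3 x, 0).
Proof.
intros Sh Ph; apply vir_ext; cbn [lc fst snd].
- intros x; field.
- rewrite omega_diag by assumption; ring.
Qed.

(** With [q = k' h - k h'], the terms without [a] and [omega] in the last three
    summands are [3 (q h)' - 3 k' h h' + 3 k (h h')' = 3 h ^ 2 k'']; those with
    [a] are [a (q''' - k' h''' + k h'''')]. *)
Lemma jacobi_spatial_fst (L a b b1 : R) (h k k1 : R -> R) (x : R) :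
  smooth h -> periodic L h -> smooth k -> periodic L k ->
  let U := (h, a) in let Y := (k, b) in let Q := bracket L Y U in
  fst (vplus (vplus (lc L U (k1, b1)) (lc L U (k1, b1)))
        (vplus (vopp (bracket L Y (lc L U U)))
               (vplus (lc L U Q) (lc L Q U)))) x =
    h x * (4 * Derive k1 x + 3 * h x * Derive_n k 2 x + a * Derive_n k 4 x)
    + Derive h x * (2 * k1 x + 2 * a * Derive_n k 3 x)
    + Derive_n h 3 x * (b1 + omega L k h - 3 * a * Derive k x)
    + a * Derive_n k1 3 x.
Proof.
intros Sh Ph Sk Pk U Y Q.
rewrite (lc_diag L a h Sh Ph : lc L U U = _).
unfold Q, Y, U, bracket; cbn [lc vplus vopp fst snd].
rewrite (Derive_bracket h k), Derive_n_3_bracket by assumption.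
rewrite Derive_smooth_plus by solve_smooth.
rewrite Derive_scal, Derive_mult by (apply smooth_ex_derive; solve_smooth).
rewrite (Derive_scal (Derive h)).
change (Derive_n h 4 x) with (Derive (Derive_n h 3) x).
change (Derive_n h 2 x) with (Derive (Derive h) x).
field.
Qed.

Lemma jacobi_spatial_snd (L a b b1 : R) (h k k1 : R -> R) :
  smooth h -> periodic L h -> smooth k -> periodic L k ->
  let U := (h, a) in let Y := (k, b) in let Q := bracket L Y U in
  snd (vplus (vplus (lc L U (k1, b1)) (lc L U (k1, b1)))
        (vplus (vopp (bracket L Y (lc L U U)))
               (vplus (lc L U Q) (lc L Q U)))) =
    - (omega L h k1 + omega L k (fun x => 3 * Derive h x * h x)
       + omega L k (fun x => a * Derive_n h 3 x)).
Proof.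
intros Sh Ph Sk Pk U Y Q.
destruct (in_vir_bracket L Y U (conj Sk Pk) (conj Sh Ph)) as [SQ PQ].
rewrite (lc_diag L a h Sh Ph : lc L U U = _).
cbn [lc vplus vopp bracket U Y fst snd].
rewrite omega_plus_r by solve_smooth.
rewrite (omega_antisym L (fst Q) h) by assumption.
field.
Qed.

(** * Geodesics and Jacobi fields on a time interval *)

Lemma open_time_interval (T1 T2 : Rbar) : open (time_interval T1 T2).
Proof. apply open_and; [apply open_Rbar_gt | apply open_Rbar_lt]. Qed.

Lemma time_interval_convex (T1 T2 : Rbar) (r s t : R) :
  time_interval T1 T2 r -> time_interval T1 T2 s -> r <= t <= s ->
  time_interval T1 T2 t.
Proof.
intros [H1 _] [_ H2] [H3 H4]; split.
- apply Rbar_lt_le_trans with r; [exact H1 | exact H3].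
- apply Rbar_le_lt_trans with s; [exact H4 | exact H2].
Qed.

Lemma constant_on_interval (T1 T2 : Rbar) (f : R -> R) :
  (forall t, time_interval T1 T2 t -> is_derive f t 0) ->
  forall s t, time_interval T1 T2 s -> time_interval T1 T2 t -> f s = f t.
Proof.
intros H.
assert (lt : forall s t, time_interval T1 T2 s -> time_interval T1 T2 t ->
  s < t -> f s = f t).
{ intros s t Hs Ht Hst; apply (eq_is_derive f); [|exact Hst].
  intros r Hr; apply H, (time_interval_convex T1 T2 s t); assumption. }
intros s t Hs Ht; destruct (Rtotal_order s t) as [h|[->|h]];
  [| reflexivity | symmetry]; apply lt; assumption.
Qed.

Lemma geodesic_equations (L : R) (Gamma : vir -> vir -> vir) (T1 T2 : Rbar)
    (u : R -> R -> R) (a : R -> R) :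
  0 < L -> levi_civita L Gamma ->
  smooth_field L (time_interval T1 T2) u ->
  smooth_on (time_interval T1 T2) a ->
  geodesic Gamma (time_interval T1 T2) (fun t => (u t, a t)) <->
     (forall s t : R, time_interval T1 T2 s -> time_interval T1 T2 t ->
        a s = a t) /\
     (forall t x : R, time_interval T1 T2 t ->
        dt u t x = - 3 * dx 1 u t x * u t x - a t * dx 3 u t x).
Proof.
intros HL HG Hu Ha.
assert (E := levi_civita_unique L _ _ HL HG (levi_civita_lc L)).
set (U := fun t => (u t, a t)).
assert (cov : forall t, time_interval T1 T2 t -> cov_dt Gamma U U t =
  (fun x => dt u t x + (3 * dx 1 u t x * u t x + a t * dx 3 u t x),
   Derive a t + 0)).
{ intros t Ht.
  assert (in_U := smooth_field_in_vir L _ u t (a t) Hu Ht).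
  unfold cov_dt; rewrite (E (U t) (U t)) by exact in_U.
  rewrite (lc_diag L (a t) (u t) (proj1 in_U) (proj2 in_U) : lc L (U t) (U t) = _).
  reflexivity. }
split.
- intros Hgeo; split.
  + apply constant_on_interval; intros t Ht.
    assert (H := Hgeo t Ht); rewrite cov in H by exact Ht.
    assert (H1 := f_equal snd H); cbn [vzero snd] in H1.
    replace 0 with (Derive a t) by lra.
    apply Derive_correct, (Ha 1%nat t Ht).
  + intros t x Ht.
    assert (H := Hgeo t Ht); rewrite cov in H by exact Ht.
    assert (H1 := f_equal (fun V : vir => fst V x) H); cbn [vzero fst] in H1.
    lra.
- intros [Ca Hu'] t Ht; rewrite cov by exact Ht.
  apply vir_ext; cbn [vzero fst snd].
  + intros x; rewrite Hu' by exact Ht; ring.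
  + rewrite Rplus_0_r, <- (Derive_const (a t) t).
    apply Derive_ext_loc.
    generalize (open_time_interval T1 T2 t Ht); apply filter_imp.
    intros s Hs; apply Ca; assumption.
Qed.

Lemma jacobi_equations (L : R) (Gamma : vir -> vir -> vir) (I : R -> Prop)
    (u y : R -> R -> R) (a b : R -> R) :
  0 < L -> levi_civita L Gamma -> open I ->
  smooth_field L I u -> smooth_on I a -> smooth_field L I y -> smooth_on I b ->
  geodesic Gamma I (fun t => (u t, a t)) ->
  jacobi_field L Gamma I (fun t => (u t, a t)) (fun t => (y t, b t)) <->
  forall t : R, I t ->
    (forall x : R,
       dt (dt y) t x =
         - u t x * (4 * dx 1 (dt y) t x + 3 * u t x * dx 2 y t x
                    + a t * dx 4 y t x)
         - dx 1 u t x * (2 * dt y t x + 2 * a t * dx 3 y t x)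
         - dx 3 u t x * (Derive b t + omega L (y t) (u t)
                         - 3 * a t * dx 1 y t x)
         - a t * dx 3 (dt y) t x) /\
    Derive_n b 2 t =
      omega L (u t) (dt y t)
      + omega L (y t) (fun x : R => 3 * dx 1 u t x * u t x)
      + omega L (y t) (fun x : R => a t * dx 3 u t x).
Proof.
intros HL HG HI Hu Ha Hy Hb Hgeo.
set (U := fun t => (u t, a t)) in *; set (Y := fun t => (y t, b t)).
assert (J : forall t, I t ->
  vplus (cov_dt Gamma U (cov_dt Gamma U Y) t)
        (curvature L Gamma (Y t) (U t) (U t)) =
  (fun x => dt (dt y) t x
     + (u t x * (4 * dx 1 (dt y) t x + 3 * u t x * dx 2 y t x
                 + a t * dx 4 y t x)
        + dx 1 u t x * (2 * dt y t x + 2 * a t * dx 3 y t x)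
        + dx 3 u t x * (Derive b t + omega L (y t) (u t)
                        - 3 * a t * dx 1 y t x)
        + a t * dx 3 (dt y) t x),
   Derive_n b 2 t
     + - (omega L (u t) (dt y t)
          + omega L (y t) (fun x : R => 3 * dx 1 u t x * u t x)
          + omega L (y t) (fun x : R => a t * dx 3 u t x)))).
{ intros t Ht.
  destruct (smooth_field_in_vir L I u t 0 Hu Ht) as [Su Pu].
  destruct (smooth_field_in_vir L I y t 0 Hy Ht) as [Sy Py].
  rewrite (jacobi_operator L Gamma I U Y t HL HG HI (conj Hu Ha) (conj Hy Hb)
             Hgeo Ht).
  apply vir_ext.
  - intros x.
    assert (E := jacobi_spatial_fst L (a t) (b t) (Derive b t) (u t) (y t)
                   (dt y t) x Su Pu Sy Py).
    cbn [vplus fst] in E |- *; rewrite Rplus_assoc.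
    exact (f_equal (Rplus (dt (dt y) t x)) E).
  - assert (E := jacobi_spatial_snd L (a t) (b t) (Derive b t) (u t) (y t)
                   (dt y t) Su Pu Sy Py).
    cbn [vplus snd] in E |- *; rewrite Rplus_assoc.
    exact (f_equal (Rplus (Derive_n b 2 t)) E). }
split.
- intros H t Ht; assert (Z := H t Ht); rewrite J in Z by exact Ht; split.
  + intros x.
    assert (Z1 := f_equal (fun V : vir => fst V x) Z); cbn [vzero fst] in Z1.
    lra.
  + assert (Z1 := f_equal snd Z); cbn [vzero snd] in Z1; lra.
- intros H t Ht; destruct (H t Ht) as [H1 H2]; rewrite J by exact Ht.
  apply vir_ext; cbn [vzero fst snd]; [intros x; rewrite H1 | rewrite H2]; ring.
Qed.

(** By antisymmetry of [omega], the terms [omega (u, y_t)] and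
    [omega (y_t, u)] of the time derivative cancel; the geodesic equation makes
    [omega (y, u_t)] cancel the two other terms of [b_tt]. *)
Lemma jacobi_momentum_constant (L : R) (T1 T2 : Rbar) (u y : R -> R -> R)
    (a b : R -> R) :
  smooth_field L (time_interval T1 T2) u ->
  smooth_field L (time_interval T1 T2) y ->
  smooth_on (time_interval T1 T2) b ->
  (forall t x : R, time_interval T1 T2 t ->
     dt u t x = - 3 * dx 1 u t x * u t x - a t * dx 3 u t x) ->
  (forall t : R, time_interval T1 T2 t ->
     Derive_n b 2 t =
       omega L (u t) (dt y t)
       + omega L (y t) (fun x : R => 3 * dx 1 u t x * u t x)
       + omega L (y t) (fun x : R => a t * dx 3 u t x)) ->
  forall s t, time_interval T1 T2 s -> time_interval T1 T2 t ->
    Derive b s + omega L (y s) (u s) = Derive b t + omega L (y t) (u t).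
Proof.
intros Hu Hy Hb Eu Eb.
assert (HI := open_time_interval T1 T2).
apply (constant_on_interval T1 T2 (fun s => Derive b s + omega L (y s) (u s))).
intros t Ht.
destruct (smooth_field_in_vir L _ u t 0 Hu Ht) as [Su Pu].
destruct (smooth_field_in_vir L _ y t 0 Hy Ht) as [Sy Py].
destruct (smooth_field_in_vir L _ _ t 0 (smooth_field_dt L _ y HI Hy) Ht)
  as [Sy' Py'].
simpl fst in *.
(* The factor -1 puts the geodesic equation into the form of a scalar multiple
   of a sum, to which omega_scal_r and omega_plus_r apply. *)
assert (E : 0 = Derive_n b 2 t
                + (omega L (dt y t) (u t) + omega L (y t) (dt u t))).
{ replace (dt u t)
    with (fun x => -1 * (3 * Derive (u t) x * u t x + a t * Derive_n (u t) 3 x)).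
  2:{ apply functional_extensionality; intros x; rewrite Eu by exact Ht.
      change (dx 1 u t x) with (Derive (u t) x); unfold dx; ring. }
  rewrite omega_scal_r, omega_plus_r, Eb, (omega_antisym L (dt y t))
    by (assumption || solve_smooth).
  unfold dx; simpl Derive_n.
  change (fun x => u t x) with (u t); ring. }
rewrite E.
apply (is_derive_plus (Derive b) (fun s => omega L (y s) (u s))).
- apply Derive_correct, (Hb 2%nat t Ht).
- apply (is_derive_omega L (time_interval T1 T2)); assumption.
Qed.

Theorem mainTheorem11 :
  forall (L : R) (hL : 0 < L)
    (Gamma : vir -> vir -> vir) (hGamma : levi_civita L Gamma)
    (T1 T2 : Rbar) (t0 : R) (ht0 : time_interval T1 T2 t0)
    (u : R -> R -> R) (a : R -> R)
    (hu : smooth_field L (time_interval T1 T2) u)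
    (ha : smooth_on (time_interval T1 T2) a),
  let I := time_interval T1 T2 in
  let U := fun t : R => (u t, a t) in
  (geodesic Gamma I U <->
     (forall s t : R, I s -> I t -> a s = a t) /\
     (forall t x : R, I t ->
        dt u t x = - 3 * dx 1 u t x * u t x - a t * dx 3 u t x)) /\
  (geodesic Gamma I U ->
   forall (y : R -> R -> R) (b : R -> R)
     (hy : smooth_field L I y) (hb : smooth_on I b),
   let Y := fun t : R => (y t, b t) in
   (jacobi_field L Gamma I U Y <->
      forall t : R, I t ->
        (forall x : R,
           dt (dt y) t x =
             - u t x * (4 * dx 1 (dt y) t x + 3 * u t x * dx 2 y t x
                        + a t * dx 4 y t x)
             - dx 1 u t x * (2 * dt y t x + 2 * a t * dx 3 y t x)
             - dx 3 u t x * (Derive b t + omega L (y t) (u t)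
                             - 3 * a t * dx 1 y t x)
             - a t * dx 3 (dt y) t x) /\
        Derive_n b 2 t =
          omega L (u t) (dt y t)
          + omega L (y t) (fun x : R => 3 * dx 1 u t x * u t x)
          + omega L (y t) (fun x : R => a t * dx 3 u t x)) /\
   (jacobi_field L Gamma I U Y ->
      exists B1 : R,
        (forall t : R, I t ->
           B1 = Derive b t + omega L (y t) (u t) /\
           B1 = Derive b t + RInt (fun x : R => dx 3 y t x * u t x) 0 L) /\
        (exists B0 : R, forall t : R, I t ->
           b t = B0 + B1 * t
             - RInt (fun s : R =>
                 RInt (fun x : R => dx 3 y s x * u s x) 0 L) t0 t) /\
        (forall t x : R, I t ->
           dt (dt y) t x =
             - u t x * (4 * dx 1 (dt y) t x + 3 * u t x * dx 2 y t x
                        + a t * dx 4 y t x)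
             - dx 1 u t x * (2 * dt y t x + 2 * a t * dx 3 y t x)
             - dx 3 u t x * (B1 - 3 * a t * dx 1 y t x)
             - a t * dx 3 (dt y) t x))).
Proof.
intros L hL Gamma hGamma T1 T2 t0 ht0 u a hu ha I U.
assert (HI := open_time_interval T1 T2).
assert (Hgeo := geodesic_equations L Gamma T1 T2 u a hL hGamma hu ha).
split; [exact Hgeo|].
intros geo y b hy hb Y.
assert (Hjac := jacobi_equations L Gamma I u y a b hL hGamma HI hu ha hy hb geo).
split; [exact Hjac|].
intros J; assert (E := proj1 Hjac J).
assert (mom := jacobi_momentum_constant L T1 T2 u y a b hu hy hb
  (proj2 (proj1 Hgeo geo)) (fun t Ht => proj2 (E t Ht))).
assert (parts : forall t, I t ->
  omega L (y t) (u t) = RInt (fun x : R => dx 3 y t x * u t x) 0 L).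
{ intros t Ht.
  destruct (smooth_field_in_vir L I u t 0 hu Ht) as [Su Pu].
  destruct (smooth_field_in_vir L I y t 0 hy Ht) as [Sy Py].
  apply omega_by_parts; assumption. }
set (B1 := Derive b t0 + omega L (y t0) (u t0)).
assert (HB1 : forall t, I t -> B1 = Derive b t + omega L (y t) (u t))
  by (intros t Ht; apply mom; assumption).
exists B1; split; [|split].
- intros t Ht; split; [|rewrite <- (parts t Ht)]; apply HB1, Ht.
- exists (b t0 - B1 * t0); intros t Ht.
  assert (between : forall s, Rmin t0 t <= s <= Rmax t0 t -> I s).
  { intros s Hs; apply (time_interval_convex T1 T2 (Rmin t0 t) (Rmax t0 t));
      [| | exact Hs].
    - unfold Rmin; destruct (Rle_dec t0 t); assumption.
    - unfold Rmax; destruct (Rle_dec t0 t); assumption. }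
  rewrite (RInt_ext _ (fun s => omega L (y s) (u s)))
    by (intros s Hs; symmetry; apply parts, between; lra).
  (* By the constancy of B1, the function B1 * s - b s is an antiderivative of
     the integrand. *)
  assert (H : is_RInt (fun s => omega L (y s) (u s)) t0 t
                (minus (B1 * t - b t) (B1 * t0 - b t0))).
  { apply (is_RInt_derive (fun s => B1 * s - b s)).
    - intros s Hs.
      replace (omega L (y s) (u s)) with (B1 - Derive b s)
        by (rewrite (HB1 s (between s Hs)); ring).
      apply (is_derive_minus (fun r => B1 * r) b).
      + auto_derive; [exact Logic.I | ring].
      + apply Derive_correct, (hb 1%nat s (between s Hs)).
    - intros s Hs; apply @ex_derive_continuous.
      eexists; apply (is_derive_omega L I); auto. }
  rewrite (is_RInt_unique _ _ _ _ H).
  unfold minus, plus, opp; simpl; ring.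
- intros t x Ht; rewrite (HB1 t Ht); apply (E t Ht).
Qed.
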